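(* Let $\mathbf d=(t_1,t_2,\dots,t_n)$ be a degree sequence for an $n$-vertex multigraph (possibly with loops), where $t_i\ge 2$ for all $i$. Let $\mathbb{E}[F_{\mathbf d}]$ be the average number of faces in a random embedding of a random multigraph with degree sequence $\mathbf d$. Then $\mathbb{E}[F_{\mathbf d}]=\Theta(\log n)$.
   Context: Here $n$ is the number of vertices. A degree sequence of a multigraph is a sequence of integers $t_1,\dots,t_n$ with even sum; put $m=\frac12\sum_{i=1}^n t_i$, the number of edges. Random multigraphs are generated by the configuration model, and a random embedding of a random multigraph with degree sequence $\mathbf d$ is the following. Let $D$ be a set of $2m$ darts, partitioned into sets $D_1,\dots,D_n$ with $|D_i|=t_i$ ($D_i$ is the set of darts at vertex $v_i$). Fix a permutation $R$ of $D$ whose cycles are exactly one cycle on each $D_i$ (the clockwise order of the darts around $v_i$), and choose a fixed-point-free involution $L$ of $D$ uniformly at random (its 2-cycles are the edges; loops and multiple edges are allowed). The number of faces $F_{\mathbf d}$ is the number of cycles of $R\circ L$. (The distribution of $F_{\mathbf d}$ does not depend on the choice of $R$.)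
   Formalization: The lower constant is absolute, but the upper constant depends on K, where the number of edges m is at most n^K; with a uniform upper constant the claim fails, e.g. for d = (2^(2^n), 2, ..., 2), where the expectation is at least (1/2) log m. Bounds are stated for n at least 2. *)

(* Defs.v *)
From HB Require Import structures.
From mathcomp Require Import all_boot all_order all_algebra all_fingroup.
From mathcomp Require Import all_classical all_reals all_analysis.

Set Implicit Arguments.
Unset Strict Implicit.
Unset Printing Implicit Defensive.

Local Open Scope ring_scope.

Definition degree_sequence (n : nat) (t : 'I_n -> nat) : bool :=
  ~~ odd (\sum_(i < n) t i)%N.

Definition num_edges (n : nat) (t : 'I_n -> nat) : nat :=
  (\sum_(i < n) t i)./2.

Section RandomEmbedding.
Variables (n : nat) (D : finType).

(* [vtx] sends a dart to its vertex, so it encodes the partition of the darts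
   into the sets [darts_at vtx i]. *)
Definition darts_at (vtx : D -> 'I_n) (i : 'I_n) : {set D} :=
  [set x | vtx x == i].

(* The cycles of [rot] (as sets of darts, fixed points included) are exactly
   the sets of darts at the vertices. *)
Definition is_rotation (vtx : D -> 'I_n) (rot : {perm D}) : Prop :=
  porbits rot = [set darts_at vtx i | i : 'I_n].

Definition edge_involutions : {set {perm D}} :=
  [set L : {perm D} | [forall x, L (L x) == x] && [forall x, L x != x]].

(* In {perm D} the product [L * rot] applies [L] first: it is rot \o L. *)
Definition num_faces (rot L : {perm D}) : nat := #|porbits (L * rot)%g|.

(* Expectation of the number of faces for uniform [L]. *)
Definition expected_faces (R : realType) (rot : {perm D}) : R :=
  (\sum_(L in edge_involutions) (num_faces rot L)%:R)
    / #|edge_involutions|%:R.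

End RandomEmbedding.

(* Main.v *)
(* Pair up the darts one at a time.  If U is the set of unpaired darts and s the
   permutation whose cycles are the faces traced so far (unpaired darts being
   fixed by L), then pairing x with y replaces s by tperm x y * s and U by
   U :\: [set x; y].  Fix x and choose y uniformly among the other 2k - 1 darts
   of U.
   - The number of cycles of s missing U never decreases, and for a suitable x
     some y increases it (the next dart of U on the cycle of x, or any y if the
     cycles all meet U at most once): it grows on average by at least
     1 / (2k - 1).
   - The number of cycles of s meeting U at most once grows only if y is at
     cyclic distance at most 2 from x in U, hence on average by at most
     4 / (2k - 1).  It is 0 at the start, as all degrees are at least 2.
   Both quantities are the number of faces once U is empty, so the expectation
   lies between H and 4 H, where H = 1 + 1/3 + ... + 1/(2m - 1). *)

Require Import Defs.
From HB Require Import structures.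
From mathcomp Require Import all_boot all_order all_algebra all_fingroup.
From mathcomp Require Import all_classical all_reals all_analysis.
From mathcomp Require Import zify lra ring.

Set Implicit Arguments.
Unset Strict Implicit.
Unset Printing Implicit Defensive.

Import Order.TTheory GRing.Theory Num.Theory.

Local Open Scope ring_scope.

(** * Cycles of a permutation multiplied by a transposition *)

Section Orbits.
Variable D : finType.
Implicit Types (s : {perm D}) (x y z : D) (O U : {set D}).

Lemma mem_porbit_iter s i x : iter i s x \in porbit s x.
Proof. by rewrite -permX mem_porbit. Qed.

Lemma porbit_subset s x O :
  {in O, forall z, s z \in O} -> x \in O -> porbit s x \subset O.
Proof.
move=> stabO Ox; apply/fintype.subsetP => _ /porbitP[i ->]; rewrite permX.
by elim: i => //= i; apply: stabO.
Qed.

(** The position of [z] on the cycle of [x], counted from [x]. Off that cycle it takes the default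
    value [#|porbit s x|]. *)
Definition porbit_idx s x z := index z (traject s x #|porbit s x|).

Lemma porbit_idx_lt s x z :
  z \in porbit s x -> (porbit_idx s x z < #|porbit s x|)%N.
Proof. by rewrite porbit_traject -index_mem size_traject. Qed.

Lemma iter_porbit_idx s x z :
  z \in porbit s x -> iter (porbit_idx s x z) s x = z.
Proof.
move=> xz; rewrite -(nth_traject _ (porbit_idx_lt xz)) nth_index //.
by rewrite -porbit_traject.
Qed.

Lemma porbit_idx_iter s x i :
  (i < #|porbit s x|)%N -> porbit_idx s x (iter i s x) = i.
Proof.
move=> lti; rewrite /porbit_idx -(nth_traject _ lti) index_uniq ?size_traject //.
exact: uniq_traject_porbit.
Qed.

Lemma porbit_idx_gt0 s x z :
  z \in porbit s x -> z != x -> (0 < porbit_idx s x z)%N.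
Proof.
move=> /iter_porbit_idx; case: (porbit_idx s x z) => //= <-.
by rewrite eqxx.
Qed.

Lemma porbit_idx_inj s x : {in porbit s x &, injective (porbit_idx s x)}.
Proof.
by move=> y z xy xz e; rewrite -(iter_porbit_idx xy) e iter_porbit_idx.
Qed.

Lemma iter_neq_start s x i :
  (0 < i < #|porbit s x|)%N -> iter i s x != x.
Proof.
move=> /andP[i0 lti]; apply/eqP => e.
have := porbit_idx_iter lti; rewrite e.
rewrite -[X in porbit_idx _ _ X]/(iter 0 s x) porbit_idx_iter; first by lia.
exact: leq_ltn_trans lti.
Qed.

(* [tperm x y * s] sends [y] to [s x], then follows [s] until it meets [x] or
   [y]. *)
Lemma iter_tpermM s x y i :
  (forall j, (0 < j <= i)%N -> (iter j s x != x) && (iter j s x != y)) ->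
  iter i.+1 (tperm x y * s)%g y = iter i.+1 s x.
Proof.
elim: i => [|i IHi] avoid; first by rewrite /= permM tpermR.
rewrite iterS IHi; last first.
  by move=> j /andP[j0 ji]; apply: avoid; rewrite j0 leqW.
have /andP[nx ny] := avoid i.+1 (ltnSn _).
by rewrite permM tpermD // eq_sym.
Qed.

(** With [y] on the cycle of [x], the product cuts this cycle in two. The arc from [s x] to [y]
    closes up into the cycle of [y]: the walk from [y] jumps to [s x] and then follows [s], reaching
    [z] before it can meet [x] or [y]. *)
Lemma porbit_before s x y z : y \in porbit s x -> z \in porbit s x ->
  (0 < porbit_idx s x z <= porbit_idx s x y)%N ->
  z \in porbit (tperm x y * s)%g y.
Proof.
move=> xy xz /andP[]; case ez: (porbit_idx s x z) => [//|i] _ lei.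
rewrite -(iter_porbit_idx xz) ez -(@iter_tpermM s x y).
  exact: mem_porbit_iter.
move=> j /andP[j0 ji]; have lty := porbit_idx_lt xy.
have ltj : (j < #|porbit s x|)%N by lia.
rewrite iter_neq_start ?j0 //=; apply/eqP => e.
by move: (porbit_idx_iter ltj); rewrite e; lia.
Qed.

(** The other arc of the cut: the walk from [x] jumps to [s y] and follows [s] towards [x]. This is
    [iter_tpermM] with [x] and [y] exchanged. *)
Lemma porbit_after s x y z : y \in porbit s x -> z \in porbit s x ->
  (porbit_idx s x y < porbit_idx s x z)%N ->
  z \in porbit (tperm x y * s)%g x.
Proof.
move=> xy xz lti; set k := (porbit_idx s x z - porbit_idx s x y).-1.
have ek : porbit_idx s x z = (k.+1 + porbit_idx s x y)%N by rewrite /k; lia.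
rewrite -(iter_porbit_idx xz) ek iterD (iter_porbit_idx xy) tpermC.
rewrite -(@iter_tpermM s y x); first exact: mem_porbit_iter.
move=> j /andP[j0 jk]; have ltz := porbit_idx_lt xz.
have ej : iter j s y = iter (j + porbit_idx s x y) s x.
  by rewrite iterD iter_porbit_idx.
have ltj : (j + porbit_idx s x y < #|porbit s x|)%N by lia.
rewrite ej [X in _ && X]iter_neq_start ?andbT; last by lia.
apply/eqP => e; have := porbit_idx_iter ltj; rewrite e; lia.
Qed.

(** Two distinct cycles are joined: the walk from [y] enters at [s x] and goes once round the cycle
    of [x], where [y] cannot stop it. *)
Lemma porbit_merge s x y :
  y \notin porbit s x -> porbit s x \subset porbit (tperm x y * s)%g y.
Proof.
move=> nxy; apply/fintype.subsetP => z xz.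
have avoid j : (0 < j < #|porbit s x|)%N ->
    (iter j s x != x) && (iter j s x != y).
  move=> ltj; rewrite iter_neq_start //=.
  by apply: contraNneq nxy => <-; apply: mem_porbit_iter.
suff [i -> lti] : exists2 i, z = iter i.+1 s x & (i < #|porbit s x|)%N.
  rewrite -(@iter_tpermM s x y); first exact: mem_porbit_iter.
  by move=> j ltj; apply: avoid; lia.
have [-> | nzx] := eqVneq z x.
  (* The dart [x] itself is reached last, after the full turn. *)
  exists #|porbit s x|.-1; rewrite prednK ?iter_porbit //;
    by have := card_porbit_neq0 s x; lia.
exists (porbit_idx s x z).-1; rewrite prednK ?porbit_idx_gt0 ?iter_porbit_idx //.
exact/ltnW/porbit_idx_lt.
Qed.

Lemma porbits_tpermM s x y O : O \in porbits s -> x \notin O -> y \notin O ->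
  O \in porbits (tperm x y * s)%g.
Proof.
move=> /imsetP[z _ ->{O}] nx ny; apply/imsetP; exists z => //.
suff e i : iter i (tperm x y * s)%g z = iter i s z.
  by apply/setP => w; apply/porbitP/porbitP => -[i ->];
    exists i; rewrite !permX e.
elim: i => //= i ->; rewrite permM tpermD //.
- by apply: contraNneq nx => ->; apply: mem_porbit_iter.
- by apply: contraNneq ny => ->; apply: mem_porbit_iter.
Qed.

Lemma porbits_eqVnotin s x O :
  O \in porbits s -> O = porbit s x \/ x \notin O.
Proof.
move=> /imsetP[z _ ->]; case: (boolP (x \in porbit s z)); last by right.
by rewrite -eq_porbit_mem => /eqP->; left.
Qed.

(** * Cycles with few unpaired darts *)

Definition light_porbits k s U := [set O in porbits s | (#|O :&: U| <= k)%N].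

Lemma light_porbits0 k s : light_porbits k s finset.set0 = porbits s.
Proof. by apply/setP => O; rewrite inE finset.setI0 cards0 andbT. Qed.

Lemma setID_pair O U x y : x \notin O -> y \notin O ->
  O :&: (U :\: [set x; y]) = O :&: U.
Proof.
move=> nx ny; apply/setP => z; rewrite !inE negb_or.
have [->|_] := eqVneq z x; first by rewrite (negPf nx).
by have [->|_] := eqVneq z y; first by rewrite (negPf ny).
Qed.

Lemma light_porbits_tpermM k s U x y O :
  x \notin O -> y \notin O ->
  (O \in light_porbits k (tperm x y * s)%g (U :\: [set x; y]))
    = (O \in light_porbits k s U).
Proof.
move=> nx ny; rewrite !inE setID_pair //; congr (_ && _).
apply/idP/idP => sO; last exact: porbits_tpermM.
(* A transposition is its own inverse, so the same lemma applied to the product leads back to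
   [s]. *)
by rewrite -[s](mulKg (tperm x y)) tpermV porbits_tpermM.
Qed.

Lemma void_porbits_sub s U x y : x \in U -> y \in U ->
  light_porbits 0 s U
    \subset light_porbits 0 (tperm x y * s)%g (U :\: [set x; y]).
Proof.
move=> Ux Uy; apply/fintype.subsetP => O lO.
have out z : z \in U -> z \notin O.
  move=> Uz; apply/negP => Oz; move: lO; rewrite inE leqn0 cards_eq0.
  by move=> /andP[_ /eqP/setP/(_ z)]; rewrite !inE Oz Uz.
by rewrite light_porbits_tpermM ?out.
Qed.

Lemma void_porbits_pair s U : (1 < #|U|)%N -> exists x y,
  [/\ x \in U, y \in U, y != x &
    (#|light_porbits 0 s U|
       < #|light_porbits 0 (tperm x y * s)%g (U :\: [set x; y])|)%N].
Proof.
move=> cU.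
(* Such a cycle misses the new set of unpaired darts, and it was not counted before because it
   contains [y], which lies in [U]. *)
suff [x [y [Ux Uy nyx /fintype.subsetP sub]]] : exists x y, [/\ x \in U, y \in U,
    y != x & porbit (tperm x y * s)%g y \subset [set x; y] :|: ~: U].
  exists x, y; split=> //; apply: proper_card; apply/properP; split.
    exact: void_porbits_sub.
  exists (porbit (tperm x y * s)%g y); rewrite !inE ?imset_f //=.
    rewrite leqn0 cards_eq0; apply/eqP/setP => z; rewrite !inE.
    apply/negP => /and3P[/sub + nz Uz].
    by rewrite !inE (negPf nz) Uz.
  apply/negP => /andP[_]; rewrite leqn0 cards_eq0 => /eqP/setP/(_ y).
  by rewrite !inE porbit_id Uy.
(* If some cycle meets [U] twice, [y] is chosen as the first dart of [U] after [x] on it. *)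
case: (boolP [exists x, exists y,
    [&& x \in U, y \in U, y != x & y \in porbit s x]]) => [|/existsPn none].
  move=> /existsP[x /existsP[y0 /and4P[Ux Uy0 ny0x xy0]]].
  pose P z := [&& z \in U, z != x & z \in porbit s x].
  have Py0 : P y0 by apply/and3P.
  case: (arg_minnP (porbit_idx s x) Py0) => y /and3P[Uy nyx xy] ymin.
  exists x, y; split=> //.
  (* The arc cut off from [s x] to [y]. It is stable under the product, and by minimality [y] is its
     only dart in [U]. *)
  set A := [set z in porbit s x | (0 < porbit_idx s x z <= porbit_idx s x y)%N].
  suff sA : porbit (tperm x y * s)%g y \subset A.
    apply: (fintype.subset_trans sA); apply/fintype.subsetP => z.
    rewrite !inE => /and3P[xz z0 zy].
    have [Uz|//] := boolP (z \in U); last by rewrite orbT.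
    rewrite orbF; have [//|nzx] := eqVneq z x; rewrite /=.
    apply/eqP/(@porbit_idx_inj s x) => //.
    by apply/eqP; rewrite eqn_leq zy ymin //; apply/and3P.
  have lty := porbit_idx_lt xy.
  have y0gt := porbit_idx_gt0 xy nyx.
  have ltI i : (0 < i <= porbit_idx s x y)%N -> iter i s x \in A.
    move=> lti; rewrite inE mem_porbit_iter porbit_idx_iter ?lti //.
    by lia.
  apply: porbit_subset => [z|]; last first.
    by rewrite inE xy y0gt leqnn.
  rewrite inE => /and3P[xz z0 zy]; rewrite permM.
  have nzx : z != x.
    rewrite -(iter_porbit_idx xz) iter_neq_start // z0.
    exact: porbit_idx_lt.
  have [->|nzy] := eqVneq z y; first by rewrite tpermR (ltI 1%N).
  rewrite tpermD 1?eq_sym // -(iter_porbit_idx xz) -iterS ltI //=.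
  rewrite ltn_neqAle zy andbT; apply: contra nzy => /eqP e.
  by apply/eqP/(@porbit_idx_inj s x).
(* Now every cycle meets [U] at most once, so any pair works: the new cycle of [y] stays inside the
   old cycles of [x] and [y]. *)
have [x Ux] : exists x, x \in U by apply/card_gt0P; lia.
have [y] : exists y, y \in U :\ x.
  by apply/card_gt0P; move: cU; rewrite (cardsD1 x U) Ux.
rewrite !inE => /andP[nyx Uy]; exists x, y; split=> //.
have alone z w : z \in U -> w \in U -> w \in porbit s z -> w = z.
  move=> Uz Uw zw; apply/eqP; apply: contraT => nwz.
  by have /existsPn/(_ w) := none z; rewrite Uz Uw nwz zw.
have sA : porbit (tperm x y * s)%g y
    \subset porbit s x :|: porbit s y.
  apply: porbit_subset => [z|]; last by rewrite inE porbit_id orbT.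
  have step w z' : z' \in porbit s w -> s z' \in porbit s w.
    by rewrite -!eq_porbit_mem -(porbit_perm s 1 z') expg1.
  rewrite !inE permM; case: tpermP => [->|->|_ _].
  - by rewrite (step y) ?porbit_id ?orbT.
  - by rewrite (step x) ?porbit_id.
  - by case/orP => /step->; rewrite ?orbT.
apply: (fintype.subset_trans sA); apply/fintype.subsetP => z; rewrite !inE.
have [Uz|] := boolP (z \in U); last by rewrite orbT.
by case/orP => /alone->; rewrite ?eqxx ?orbT.
Qed.

Lemma light_porbits_tpermM_sub k s U x y :
  light_porbits k (tperm x y * s)%g (U :\: [set x; y])
    \subset porbit (tperm x y * s)%g x |: (porbit (tperm x y * s)%g y |:
      (light_porbits k s U :\: [set porbit s x; porbit s y])).
Proof.
apply/fintype.subsetP => O lO; rewrite !inE.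
have sO : O \in porbits (tperm x y * s)%g by move: lO; rewrite inE => /andP[].
have [->|nx] := porbits_eqVnotin x sO; first by rewrite eqxx.
have [->|ny] := porbits_eqVnotin y sO; first by rewrite eqxx orbT.
rewrite light_porbits_tpermM // in lO; apply/orP; right; apply/orP; right.
move: (lO); rewrite inE => ->; rewrite andbT negb_or; apply/andP; split.
- by apply: contraNneq nx => ->; apply: porbit_id.
- by apply: contraNneq ny => ->; apply: porbit_id.
Qed.

(** Only the merged cycle could be a new light one. If it is light, one of the two cycles it absorbs
    was light too and disappears. Otherwise each of them would bring a further unpaired dart, making
    two in the merged cycle. *)
Lemma light_porbits1_merge s U x y : x \in U -> y \in U ->
  y \notin porbit s x ->
  (#|light_porbits 1 (tperm x y * s)%g (U :\: [set x; y])|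
     <= #|light_porbits 1 s U|)%N.
Proof.
move=> Ux Uy nxy; set s' := (tperm x y * s)%g; set U' := U :\: [set x; y].
have sx : porbit s x \subset porbit s' y by apply: porbit_merge.
have sy : porbit s y \subset porbit s' x.
  by rewrite /s' tpermC; apply: porbit_merge; rewrite porbit_sym.
have exy : porbit s' x = porbit s' y.
  by apply/eqP; rewrite eq_porbit_mem (fintype.subsetP sx) ?porbit_id.
have := light_porbits_tpermM_sub 1 s U x y; rewrite -/s' -/U' exy.
rewrite finset.setUA finset.setUid.
have [lm|nlm] := boolP (porbit s' y \in light_porbits 1 s' U'); last first.
  move=> sub; apply/subset_leq_card/fintype.subsetP => O lO.
  have := fintype.subsetP sub O lO; rewrite !inE.
  case/orP => [/eqP eO|/and3P[_ -> //]]; by rewrite -eO lO in nlm.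
move=> /subset_leq_card/leq_trans; apply.
suff [A lA Axy] : exists2 A, A \in light_porbits 1 s U &
    A \in [set porbit s x; porbit s y].
  rewrite cardsU1 (cardsD1 A (light_porbits 1 s U)) lA.
  apply: leq_add; first by case: (_ \notin _).
  apply/subset_leq_card/fintype.subsetP => P; rewrite !inE.
  case/and3P => /norP[nx ny] -> ->; rewrite !andbT.
  by apply: contraNneq nx => eP; move: Axy; rewrite -eP !inE (negPf ny) orbF.
have [lx|nlx] := boolP (porbit s x \in light_porbits 1 s U).
  by exists (porbit s x); rewrite // !inE eqxx.
have [ly|nly] := boolP (porbit s y \in light_porbits 1 s U).
  by exists (porbit s y); rewrite // !inE eqxx orbT.
have heavy z : z \in U -> porbit s z \notin light_porbits 1 s U ->
    exists2 w, w \in porbit s z & (w \in U) && (w != z).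
  move=> Uz; rewrite inE imset_f //= -ltnNge (cardsD1 z) !inE porbit_id Uz.
  rewrite ltnS => /card_gt0P[w]; rewrite !inE => /and3P[nwz zw Uw].
  by exists w => //; apply/andP.
have [v xv /andP[Uv nvx]] := heavy x Ux nlx.
have [w yw /andP[Uw nwy]] := heavy y Uy nly.
have disj z : z \in porbit s x -> z \notin porbit s y.
  rewrite -!eq_porbit_mem => /eqP->.
  by rewrite eq_porbit_mem porbit_sym.
suff: (1 < #|porbit s' y :&: U'|)%N.
  by move: lm; rewrite inE => /andP[_]; rewrite leqNgt => /negP.
have nvw : v != w by apply: contraNneq (disj v xv) => ->.
(* Here 2 is turned into [(v != w).+1], the cardinality of [[set v; w]]. *)
rewrite -[2%N]/((true : nat).+1) -nvw -cards2; apply: subset_leq_card.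
apply/fintype.subsetP => z; rewrite !inE negb_or => /orP[]/eqP->.
- rewrite (fintype.subsetP sx) // Uv nvx !andbT /=.
  by apply: contraNneq (disj v xv) => ->; apply: porbit_id.
- rewrite -exy (fintype.subsetP sy) // Uw nwy !andbT /=.
  by apply: contraTneq yw => ->; apply/disj/porbit_id.
Qed.

(** Take the admissible [y] farthest from [x]. All other admissible darts lie on the arc before it,
    hence are unpaired darts of the new cycle of [y], which has at most one. *)
Lemma card_light_successors s U x :
  (#|[set y in U :\ x | (y \in porbit s x) &&
      (#|porbit (tperm x y * s)%g y :&: (U :\: [set x; y])| <= 1)%N]| <= 2)%N.
Proof.
set Y := [set y in _ | _].
have [->|[y0 Yy0]] := set_0Vmem Y; first by rewrite cards0.
case: (arg_maxnP (porbit_idx s x) Yy0) => y; rewrite -/(y \in Y) => Yy ymax.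
have := Yy; rewrite /Y !inE => /and3P[/andP[nyx Uy] xy le1].
rewrite (cardsD1 y) Yy; apply: leq_trans le1.
apply/subset_leq_card/fintype.subsetP => z; rewrite inE.
case/andP; rewrite inE => nzy Yz.
have := Yz; rewrite /Y !inE => /and3P[/andP[nzx Uz] xz _].
rewrite (negPf nzx) (negPf nzy) Uz !andbT.
by apply: porbit_before; rewrite ?porbit_idx_gt0 //; apply: ymax.
Qed.

(** Mirror image: the admissible [y] nearest to [x] leaves all the others on the new cycle of
    [x]. *)
Lemma card_light_predecessors s U x :
  (#|[set y in U :\ x | (y \in porbit s x) &&
      (#|porbit (tperm x y * s)%g x :&: (U :\: [set x; y])| <= 1)%N]| <= 2)%N.
Proof.
set Y := [set y in _ | _].
have [->|[y0 Yy0]] := set_0Vmem Y; first by rewrite cards0.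
case: (arg_minnP (porbit_idx s x) Yy0) => y; rewrite -/(y \in Y) => Yy ymin.
have := Yy; rewrite /Y !inE => /and3P[/andP[nyx Uy] xy le1].
rewrite (cardsD1 y) Yy; apply: leq_trans le1.
apply/subset_leq_card/fintype.subsetP => z; rewrite inE.
case/andP; rewrite inE => nzy Yz.
have := Yz; rewrite /Y !inE => /and3P[/andP[nzx Uz] xz _].
rewrite (negPf nzx) (negPf nzy) Uz !andbT.
apply: porbit_after => //; rewrite ltn_neqAle ymin // andbT.
by apply: contraNneq nzy => /porbit_idx_inj->.
Qed.

(** A merge gains nothing. A cut gains at most the two new cycles, and each of these is light for at
    most two choices of [y], whence the 4. *)
Lemma sum_light_porbits1 s U x : x \in U ->
  (\sum_(y in U :\ x) #|light_porbits 1 (tperm x y * s)%g (U :\: [set x; y])|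
     <= #|U :\ x| * #|light_porbits 1 s U| + 4)%N.
Proof.
move=> Ux; set Y1 := [set y in U :\ x | (y \in porbit s x) &&
  (#|porbit (tperm x y * s)%g y :&: (U :\: [set x; y])| <= 1)%N].
set Y2 := [set y in U :\ x | (y \in porbit s x) &&
  (#|porbit (tperm x y * s)%g x :&: (U :\: [set x; y])| <= 1)%N].
have sub1 : Y1 \subset U :\ x.
  by apply/fintype.subsetP => y; rewrite inE => /andP[].
have sub2 : Y2 \subset U :\ x.
  by apply/fintype.subsetP => y; rewrite inE => /andP[].
have sum_mem (Y : {set D}) : Y \subset U :\ x ->
    (\sum_(y in U :\ x) (y \in Y) = #|Y|)%N.
  move=> /finset.setIidPr <-; rewrite -sum1_card big_mkcond [RHS]big_mkcond.
  apply: eq_bigr => y _; rewrite [y \in _ :&: Y]inE.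
  by case: (y \in U :\ x).
apply: (@leq_trans (\sum_(y in U :\ x)
    (#|light_porbits 1 s U| + (y \in Y1) + (y \in Y2)))); last first.
  rewrite !big_split /= sum_nat_const !sum_mem // -addnA leq_add2l.
  exact: leq_add (card_light_successors _ _ _) (card_light_predecessors _ _ _).
apply: leq_sum => y Uxy; have := Uxy; rewrite !inE => /andP[nyx Uy].
rewrite nyx Uy.
have [xy|nxy] /= := boolP (y \in porbit s x); last first.
  by rewrite !addn0 light_porbits1_merge.
set s' := (tperm x y * s)%g; set U' := U :\: [set x; y].
have cardI (O : {set D}) (b : bool) :
    (#|if b then [set O] else finset.set0| <= b)%N.
  by case: b; rewrite ?cards1 ?cards0.
pose lx :=
  if (#|porbit s' x :&: U'| <= 1)%N then [set porbit s' x] else finset.set0.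
pose ly :=
  if (#|porbit s' y :&: U'| <= 1)%N then [set porbit s' y] else finset.set0.
have sub : light_porbits 1 s' U' \subset light_porbits 1 s U :|: ly :|: lx.
  apply/fintype.subsetP => O lO; rewrite !finset.in_setU.
  have lightO : (#|O :&: U'| <= 1)%N by move: lO; rewrite inE => /andP[].
  have := fintype.subsetP (light_porbits_tpermM_sub 1 s U x y) O lO.
  rewrite finset.in_setU1 finset.in_setU1 finset.in_setD.
  case/or3P => [/eqP eO|/eqP eO|/andP[_ ->] //].
  - by rewrite /lx -eO lightO inE eqxx !orbT.
  - by rewrite /ly -eO lightO inE eqxx !orbT.
apply: leq_trans (subset_leq_card sub) _.
apply: leq_trans (leq_card_setU _ _) (leq_add _ (cardI _ _)).
exact: leq_trans (leq_card_setU _ _) (leq_add _ (cardI _ _)).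
Qed.

End Orbits.

(** * Averaging over random pairings *)

Section Involutions.
Variable D : finType.
Implicit Types (s L : {perm D}) (x y z : D) (U : {set D}).

(** Pairings of [U], extended by the identity outside so that they remain permutations of all darts
    during the recursion. *)
Definition involutions_on U : {set {perm D}} :=
  [set L : {perm D} | [forall x, L (L x) == x]
                      && [forall x, (L x != x) == (x \in U)]].

Lemma involutions_onP U L :
  reflect (involutive L /\ forall z, (L z != z) = (z \in U))
          (L \in involutions_on U).
Proof.
rewrite inE; apply: (iffP andP) => -[LL LU]; split.
- by move=> z; apply/eqP/(forallP LL).
- by move=> z; apply: (eqP (forallP LU z)).
- by apply/forallP => z; rewrite LL.
- by apply/forallP => z; rewrite LU.
Qed.

Lemma involutions_onT : involutions_on [set: D] = edge_involutions D.
Proof.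
apply/setP => L; rewrite !inE; congr (_ && _).
by apply: eq_forallb => x; rewrite finset.in_setT eqb_id.
Qed.

Lemma involutions_on0 : involutions_on finset.set0 = [set 1%g].
Proof.
apply/setP => L; rewrite inE [RHS]inE; apply/andP/eqP => [[_ /forallP LU]|->].
  apply/permP => z; rewrite perm1; apply/eqP.
  by have := LU z; rewrite inE eqbF_neg negbK.
by split; apply/forallP => z; rewrite ?perm1 ?eqxx ?inE.
Qed.

(** The product erases the edge joining [x] and [y]. Conversely, if the product fixes [x] and [y],
    then [L] must exchange them. *)
Lemma involutions_on_mul_tperm U x y L : x \in U -> y \in U -> y != x ->
  (L \in involutions_on U) && (L x == y)
    = ((L * tperm x y)%g \in involutions_on (U :\: [set x; y])).
Proof.
move=> Ux Uy nyx; apply/andP/involutions_onP.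
  move=> [/involutions_onP[LL LU] /eqP Lx].
  have Ly : L y = x by rewrite -Lx LL.
  have Ltx z : z != x -> z != y -> (L z != x) && (L z != y).
    by move=> nzx nzy; rewrite -{1}Lx -{1}Ly !(inj_eq perm_inj) nzy.
  split=> z; rewrite !permM.
    have [->|nzx] := eqVneq z x; first by rewrite Lx tpermR Lx tpermR.
    have [->|nzy] := eqVneq z y; first by rewrite Ly tpermL Ly tpermL.
    have /andP[nx ny] := Ltx z nzx nzy.
    rewrite [tperm x y (L z)]tpermD 1?eq_sym // LL.
    by rewrite tpermD 1?eq_sym.
  rewrite !inE.
  have [->|nzx] := eqVneq z x; first by rewrite Lx tpermR eqxx.
  have [->|nzy] := eqVneq z y; first by rewrite Ly tpermL eqxx.
  have /andP[nx ny] := Ltx z nzx nzy.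
  by rewrite tpermD ?LU // eq_sym.
move=> [LL LU].
have fx : tperm x y (L x) = x.
  by have := LU x; rewrite permM !inE eqxx => /negbFE/eqP.
have fy : tperm x y (L y) = y.
  by have := LU y; rewrite permM !inE eqxx orbT => /negbFE/eqP.
have Lx : L x = y by rewrite -[L x](tpermK x y) fx tpermL.
have Ly : L y = x by rewrite -[L y](tpermK x y) fy tpermR.
split; last by rewrite Lx.
have Ltx z : z != x -> z != y -> (L z != x) && (L z != y).
  by move=> nzx nzy; rewrite -{1}Lx -{1}Ly !(inj_eq perm_inj) nzy.
have Lt z : z != x -> z != y -> tperm x y (L z) = L z.
  move=> nzx nzy; have /andP[nx ny] := Ltx z nzx nzy.
  by rewrite tpermD // eq_sym.
apply/involutions_onP; split=> z.
  have [->|nzx] := eqVneq z x; first by rewrite Lx.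
  have [->|nzy] := eqVneq z y; first by rewrite Ly.
  have /andP[nx ny] := Ltx z nzx nzy.
  by have := LL z; rewrite !permM !Lt.
have [->|nzx] := eqVneq z x; first by rewrite Lx nyx Ux.
have [->|nzy] := eqVneq z y; first by rewrite Ly eq_sym nyx Uy.
by have := LU z; rewrite permM Lt // !inE (negPf nzx) (negPf nzy).
Qed.

(** The sum is split according to the partner [y] of [x], and the edge is then stripped off by an
    involutive reindexing. *)
Lemma sum_involutions_on (V : nmodType) (F : {perm D} -> V) U x : x \in U ->
  \sum_(L in involutions_on U) F L =
  \sum_(y in U :\ x) \sum_(L in involutions_on (U :\: [set x; y]))
    F (L * tperm x y)%g.
Proof.
move=> Ux.
rewrite (partition_big (fun L : {perm D} => L x) (mem (U :\ x))) /=; last first.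
  move=> L /involutions_onP[LL LU]; rewrite !inE LU Ux /=.
  by rewrite -LU LL eq_sym LU.
apply: eq_bigr => y; rewrite !inE => /andP[nyx Uy].
have tK : involutive (fun L : {perm D} => L * tperm x y)%g.
  by move=> L; rewrite -mulgA tperm2 mulg1.
rewrite (reindex_inj (inv_inj tK)) /=; apply: eq_bigl => L.
by rewrite involutions_on_mul_tperm // tK.
Qed.

(** The double factorial (2k - 1)!!. *)
Definition num_involutions k : nat := \prod_(j < k) j.*2.+1.

Lemma num_involutions_gt0 k : (0 < num_involutions k)%N.
Proof. by rewrite /num_involutions prodn_gt0. Qed.

Lemma card_setD_pair U x y : x \in U -> y \in U :\ x ->
  #|U| = #|U :\: [set x; y]|.+2.
Proof.
move=> Ux Uy; rewrite (cardsD1 x) Ux (cardsD1 y) Uy.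
by rewrite finset.setDDl.
Qed.

Lemma card_involutions_on k U :
  #|U| = k.*2 -> #|involutions_on U| = num_involutions k.
Proof.
elim: k U => [|k IHk] U cU.
  move/eqP: cU; rewrite cards_eq0 => /eqP->.
  by rewrite involutions_on0 cards1 /num_involutions big_ord0.
have [x Ux] : exists x, x \in U by apply/card_gt0P; rewrite cU.
rewrite -sum1_card (sum_involutions_on _ Ux).
under eq_bigr => y Uy.
  rewrite sum1_card IHk; first over.
  by have := card_setD_pair Ux Uy; rewrite cU doubleS => -[<-].
have -> : num_involutions k.+1 = (num_involutions k * k.*2.+1)%N.
  by rewrite /num_involutions big_ord_recr.
rewrite sum_nat_const mulnC; congr (_ * _)%N.
by apply/eqP; rewrite -eqSS -doubleS -cU (cardsD1 x U) Ux.
Qed.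

Definition odd_harmonic (R : realType) k : R := \sum_(j < k) (j.*2.+1)%:R^-1.

(** A submartingale argument: the potential [phi] gains on average at least a / (2k - 1) when 2k
    darts are unpaired, and these gains add up. The dart [x] may depend on [s] and [U]. The sign of
    [a] is free, so upper bounds follow by negating the potential. *)
Lemma sum_involutions_drift (R : realType) (F : {perm D} -> R)
    (phi : {perm D} -> {set D} -> R) (a : R) :
  (forall s, phi s finset.set0 <= F s) ->
  (forall s U, (1 < #|U|)%N -> exists2 x, x \in U &
    #|U :\ x|%:R * phi s U + a <=
      \sum_(y in U :\ x) phi (tperm x y * s)%g (U :\: [set x; y])) ->
  forall k s U, #|U| = k.*2 ->
  #|involutions_on U|%:R * (phi s U + a * odd_harmonic R k) <=
    \sum_(L in involutions_on U) F (L * s)%g.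
Proof.
move=> phi0 drift; elim=> [|k IHk] s U cU.
  move/eqP: cU; rewrite cards_eq0 => /eqP->.
  rewrite involutions_on0 big_set1 cards1 mul1g mul1r.
  by rewrite /odd_harmonic big_ord0 mulr0 addr0.
have [x Ux dr] := drift s U ltac:(by rewrite cU).
rewrite (sum_involutions_on _ Ux) (card_involutions_on cU).
have cUx : #|U :\ x| = k.*2.+1.
  by apply/eqP; rewrite -eqSS -doubleS -cU (cardsD1 x U) Ux.
have -> : num_involutions k.+1 = (num_involutions k * k.*2.+1)%N.
  by rewrite /num_involutions big_ord_recr.
apply: (@le_trans _ _ (\sum_(y in U :\ x) (num_involutions k)%:R *
    (phi (tperm x y * s)%g (U :\: [set x; y]) + a * odd_harmonic R k))).
  rewrite -mulr_sumr big_split /= sumr_const cUx natrM -mulrA.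
  apply: ler_wpM2l; first exact: ler0n.
  have -> : odd_harmonic R k.+1 = odd_harmonic R k + (k.*2.+1)%:R^-1.
    by rewrite /odd_harmonic big_ord_recr.
  rewrite -[_ *+ k.*2.+1]mulr_natl; rewrite cUx in dr.
  set N : R := k.*2.+1%:R in dr *.
  have N0 : N != 0 by rewrite pnatr_eq0.
  (* Multiplied by [N], the last term a / N of the harmonic part is exactly the [a] supplied by
     [dr]. *)
  apply: le_trans (lerD dr (lexx _)).
  by rewrite le_eqVlt; apply/orP; left; apply/eqP; field.
apply: ler_sum => y Uy.
have cU' : #|U :\: [set x; y]| = k.*2.
  by have := card_setD_pair Ux Uy; rewrite cU doubleS => -[<-].
rewrite -(card_involutions_on cU').
apply: le_trans (IHk _ _ cU') _.
by apply: ler_sum => L _; rewrite mulgA.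
Qed.

End Involutions.

(** * Logarithmic bounds for odd harmonic sums *)

Section OddHarmonic.
Variable R : realType.

Lemma ln_succ_le n : ln (n.+2%:R : R) - ln n.+1%:R <= n.+1%:R^-1.
Proof.
have p1 : 0 < n.+1%:R :> R by rewrite ltr0n.
rewrite -ln_div ?posrE ?ltr0n // -[n.+2]addn1 natrD mulrDl divff ?gt_eqF //.
rewrite mul1r; apply: le_ln1Dx.
by apply: (@lt_trans _ _ 0); rewrite ?invr_gt0 ?ltrN10.
Qed.

(** This is ln (1 - u) <= - u at u = 1 / (n + 2). *)
Lemma ln_succ_ge n : n.+2%:R^-1 <= ln (n.+2%:R : R) - ln n.+1%:R.
Proof.
have p2 : 0 < n.+2%:R :> R by rewrite ltr0n.
rewrite -[leRHS]opprB lerNr -ln_div ?posrE ?ltr0n //.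
have -> : n.+1%:R / n.+2%:R = 1 + - n.+2%:R^-1 :> R.
  have -> : n.+1%:R = n.+2%:R - 1 :> R by rewrite -[n.+2]addn1 natrD addrK.
  by rewrite mulrBl divff ?lt0r_neq0 // mul1r.
by apply: le_ln1Dx; rewrite ltrN2 invf_lt1 // ltr1n.
Qed.

Lemma odd_harmonic_ge k : ln (k.+1%:R : R) / 2 <= odd_harmonic R k.
Proof.
elim: k => [|k IHk]; first by rewrite ln1 mul0r /odd_harmonic big_ord0.
have -> : odd_harmonic R k.+1 = odd_harmonic R k + (k.*2.+1)%:R^-1.
  by rewrite /odd_harmonic big_ord_recr.
have : k.+1%:R^-1 / 2 <= (k.*2.+1)%:R^-1 :> R.
  rewrite -invfM -natrM lef_pV2 ?posrE ?ltr0n ?muln_gt0 // ler_nat; lia.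
have aux (a b c d e : R) :
    a / 2 <= d -> b - a <= c -> c / 2 <= e -> b / 2 <= d + e by lra.
exact: aux IHk (ln_succ_le k).
Qed.

(** The crude bound 1 / (2j + 1) <= 1 / (j + 1) reduces this to the ordinary harmonic sum; the lost
    factor 2 does not affect the order of growth. *)
Lemma odd_harmonic_le k : (0 < k)%N -> odd_harmonic R k <= 1 + ln k%:R.
Proof.
case: k => // k _; elim: k => [|k IHk].
  by rewrite ln1 addr0 /odd_harmonic big_ord1 invr1.
have -> : odd_harmonic R k.+2 = odd_harmonic R k.+1 + (k.+1.*2.+1)%:R^-1.
  by rewrite /odd_harmonic big_ord_recr.
have : (k.+1.*2.+1)%:R^-1 <= k.+2%:R^-1 :> R.
  by rewrite lef_pV2 ?posrE ?ltr0n // ler_nat; lia.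
have aux (a b c d e : R) :
    d <= 1 + a -> c <= b - a -> e <= c -> d + e <= 1 + b by lra.
exact: aux IHk (ln_succ_ge k).
Qed.

End OddHarmonic.

(** * Bounds on the expected number of faces *)

Section ExpectedFaces.
Variables (R : realType) (D : finType) (k : nat).
Hypothesis cardD : #|D| = k.*2.
Implicit Types s : {perm D}.

Lemma card_edge_involutions : #|edge_involutions D| = num_involutions k.
Proof.
by rewrite -involutions_onT; apply: card_involutions_on; rewrite cardsT.
Qed.

Lemma expected_faces_ge s : odd_harmonic R k <= expected_faces R s.
Proof.
rewrite /expected_faces ler_pdivlMr ?card_edge_involutions
  ?ltr0n ?num_involutions_gt0 // -card_edge_involutions -involutions_onT mulrC.
pose phi s U : R := #|light_porbits 0 s U|%:R.
set I := involutions_on _.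
apply: (@le_trans _ _ (#|I|%:R * (phi s [set: D] + 1 * odd_harmonic R k))).
  by apply: ler_wpM2l; rewrite ?ler0n // mul1r lerDr ler0n.
apply: (@sum_involutions_drift _ _ (fun L : {perm D} => #|porbits L|%:R) phi)
  => [s' | s' U cU | ]; last by rewrite cardsT.
  by rewrite /phi light_porbits0.
have [x [y [Ux Uy nyx gain]]] := void_porbits_pair s' cU.
have Uxy : y \in U :\ x by rewrite !inE nyx.
(* The partner [y] gains at least one cycle and no other partner loses any, so the drift holds with
   [a] = 1. *)
exists x => //; rewrite (bigD1 y Uxy) /= [X in X%:R * _](cardsD1 y) Uxy.
rewrite natrD mulrDl mul1r addrAC lerD //.
  by rewrite /phi natr1 ler_nat.
rewrite mulr_natl -sumr_const.
rewrite [leLHS](eq_bigl (fun z => (z \in U :\ x) && (z != y))); last first.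
  by move=> z; rewrite !inE andbC.
apply: ler_sum => z /andP[]; rewrite !inE => /andP[_ Uz] _.
by rewrite /phi ler_nat subset_leq_card // void_porbits_sub.
Qed.

(** The drift lemma is used with the negated count and [a] = -4. The hypothesis on [s] makes the
    initial count zero. *)
Lemma expected_faces_le s : (forall P, P \in porbits s -> (1 < #|P|)%N) ->
  expected_faces R s <= 4 * odd_harmonic R k.
Proof.
move=> big_s.
rewrite /expected_faces ler_pdivrMr ?card_edge_involutions
  ?ltr0n ?num_involutions_gt0 // -card_edge_involutions -involutions_onT.
pose phi s U : R := - #|light_porbits 1 s U|%:R.
have phiT : phi s [set: D] = 0.
  rewrite /phi; apply/eqP; rewrite oppr_eq0 pnatr_eq0 cards_eq0.
  apply/eqP/setP => P; rewrite !inE finset.setIT.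
  by apply/negP => /andP[/big_s]; rewrite ltnNge => /negP.
rewrite -lerN2 -sumrN mulrC -mulrN -mulNr -[- 4 * _]add0r -{1}phiT.
apply: (@sum_involutions_drift _ _ (fun L : {perm D} => - #|porbits L|%:R) phi).
- by move=> s'; rewrite /phi light_porbits0.
- move=> s' U cU; have [x Ux] : exists x, x \in U by apply/card_gt0P; lia.
  exists x => //; rewrite /phi mulrN sumrN -opprD lerN2 -natr_sum -natrM -natrD.
  by rewrite ler_nat sum_light_porbits1.
- by rewrite cardsT.
Qed.

End ExpectedFaces.

(* The implied lower constant c is absolute; the implied upper constant C may
   depend on an exponent K with m <= n ^ K.  Every degree sequence with n >= 2
   has such a K.  C cannot be absolute: for fixed n the expectation tends to
   infinity with the degrees. *)
Theorem theorem1p11 (R : realType) :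
  exists2 c : R, 0 < c &
    forall K : nat, exists2 C : R, 0 < C &
      forall (n : nat) (t : 'I_n -> nat) (D : finType) (vtx : D -> 'I_n)
             (rot : {perm D}),
        (2 <= n)%N ->
        degree_sequence t ->
        (forall i : 'I_n, (2 <= t i)%N) ->
        (num_edges t <= n ^ K)%N ->
        (forall i : 'I_n, #|darts_at vtx i| = t i) ->
        is_rotation vtx rot ->
        c * ln (n%:R : R) <= expected_faces R rot <= C * ln (n%:R : R).
Proof.
(* The factor 1/2 is that of [odd_harmonic_ge]. *)
exists (1 / 2); first lra.
(* From 4 (1 + ln m): the 1 is at most ln n / ln 2 as n >= 2, and ln m is at most K ln n. *)
move=> K; exists (4 * ((ln 2)^-1 + K%:R)).
  by rewrite mulr_gt0 // ltr_wpDr // invr_gt0 ln_gt0 // ltr1n.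
move=> n t D vtx rot n2 even_t t2 mK deg_t rot_vtx.
set k := num_edges t in mK.
have cardD : #|D| = k.*2.
  rewrite /k /num_edges halfK (negPf even_t) subn0 -sum1_card.
  rewrite (partition_big vtx predT) //=; apply: eq_bigr => i _.
  by rewrite -deg_t -sum1_card; apply: eq_bigl => x; rewrite inE.
(* Degrees at least 2 force at least n edges, so a logarithm in m bounds one in n. *)
have le_nk : (n <= k)%N.
  rewrite -leq_double -cardD /k /num_edges.
  have <- : (\sum_(i < n) 2)%N = n.*2 by rewrite sum_nat_const card_ord muln2.
  rewrite cardD /k /num_edges halfK (negPf even_t) subn0.
  exact: leq_sum.
have ln2 : 0 < ln (2 : R) by rewrite ln_gt0 // ltr1n.
have n_gt0 : (0 < n)%N by lia.
have le_ln a b : (0 < a <= b)%N -> ln (a%:R : R) <= ln b%:R.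
  move=> /andP[a0 ab]; rewrite ler_ln ?posrE ?ltr0n ?ler_nat //.
  exact: leq_trans ab.
apply/andP; split.
  apply: le_trans (expected_faces_ge R cardD rot).
  apply: le_trans (odd_harmonic_ge R k).
  rewrite mulrC mul1r ler_wpM2r ?invr_ge0 //.
  by apply: le_ln; rewrite n_gt0 leqW.
have big_rot P : P \in porbits rot -> (1 < #|P|)%N.
  by rewrite rot_vtx => /imsetP[i _ ->]; rewrite deg_t.
apply: le_trans (expected_faces_le R cardD big_rot) _.
have k_gt0 : (0 < k)%N by lia.
rewrite -mulrA; apply: ler_wpM2l => //.
apply: le_trans (odd_harmonic_le R k_gt0) _.
rewrite mulrDl; apply: lerD.
  by rewrite mulrC ler_pdivlMr // mul1r (le_ln 2%N).
apply: le_trans (le_ln k (n ^ K)%N _) _; first by rewrite k_gt0.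
by rewrite natrX lnXn ?ltr0n // mulr_natl.
Qed.
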